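(* Let $U$ be either the cube $I^3$ or the tetrahedron $\Delta^3$, let $p\ge 1$ be an integer, and let $F:U\to\mathbb{R}^3$ be a polynomial function of degree at most $p$ (degree at most $p$ in each individual coordinate if $U=I^3$, total degree at most $p$ if $U=\Delta^3$). Let $G_\xi,G_\eta,G_\zeta$ be the lists of Bernstein-Bézier control points of $\partial F/\partial\xi,\partial F/\partial\eta,\partial F/\partial\zeta$. Then the following are equivalent: (1) the matrix $[\mathbf{u},\mathbf{v},\mathbf{w}]$ with columns $\mathbf{u},\mathbf{v},\mathbf{w}$ is invertible for every $\mathbf{u}\in\operatorname{hull}(G_\xi)$, $\mathbf{v}\in\operatorname{hull}(G_\eta)$, $\mathbf{w}\in\operatorname{hull}(G_\zeta)$; (2) there exist vectors $\mathbf{h}_1,\mathbf{h}_2,\mathbf{h}_3,\mathbf{h}_4\in\mathbb{R}^3$ such that $\mathbf{h}_1^T\mathbf{f}>0$ for all $\mathbf{f}\in G_\xi\cup G_\eta\cup G_\zeta$; $\mathbf{h}_2^T\mathbf{f}>0$ for all $\mathbf{f}\in G_\xi\cup G_\eta\cup(-G_\zeta)$; $\mathbf{h}_3^T\mathbf{f}>0$ for all $\mathbf{f}\in G_\xi\cup(-G_\eta)\cup G_\zeta$; and $\mathbf{h}_4^T\mathbf{f}>0$ for all $\mathbf{f}\in G_\xi\cup(-G_\eta)\cup(-G_\zeta)$.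
   Context: $\operatorname{hull}$ denotes convex hull, and $-G=\{-\mathbf{f}:\mathbf{f}\in G\}$. $I^3=[0,1]^3$; $\Delta^3=\{(\xi,\eta,\zeta):\xi,\eta,\zeta\ge 0,\ \xi+\eta+\zeta\le 1\}$. Bernstein-Bézier (BB) form: $F$ is written uniquely with control points $\mathbf{f}_{i,j,k}\in\mathbb{R}^3$ as follows. On $I^3$: $F(\xi,\eta,\zeta)=\sum_{i,j,k=0}^p \mathbf{f}_{i,j,k}\binom{p}{i}\binom{p}{j}\binom{p}{k}(1-\xi)^{p-i}\xi^i(1-\eta)^{p-j}\eta^j(1-\zeta)^{p-k}\zeta^k$. On $\Delta^3$: $F(\xi,\eta,\zeta)=\sum_{i,j,k\ge 0,\,i+j+k\le p}\mathbf{f}_{i,j,k}\frac{p!}{i!\,j!\,k!\,(p-i-j-k)!}\xi^i\eta^j\zeta^k(1-\xi-\eta-\zeta)^{p-i-j-k}$. $G_\xi$, $G_\eta$, $G_\zeta$ are the finite lists of all vectors $p(\mathbf{f}_{i+1,j,k}-\mathbf{f}_{i,j,k})$, $p(\mathbf{f}_{i,j+1,k}-\mathbf{f}_{i,j,k})$, $p(\mathbf{f}_{i,j,k+1}-\mathbf{f}_{i,j,k})$ respectively, over all indices for which both control points are defined. These are the BB control points of $\partial F/\partial\xi$, $\partial F/\partial\eta$, $\partial F/\partial\zeta$ respectively. *)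

(* Defs.v *)
From mathcomp Require Import all_boot all_order all_algebra.
From mathcomp Require Import reals.
From mathcomp.multinomials Require Import mpoly.

Set Implicit Arguments.
Unset Strict Implicit.
Unset Printing Implicit Defensive.

Import Order.TTheory GRing.Theory Num.Theory.
Local Open Scope ring_scope.

Inductive domain := Cube | Tetrahedron.

Definition in_domain (R : realType) (U : domain) (x : 'cV[R]_3) : bool :=
  match U with
  | Cube => [forall d, 0 <= x d 0 <= 1]
  | Tetrahedron => [forall d, 0 <= x d 0] && (\sum_d x d 0 <= 1)
  end.

Definition points (R : realType) (U : domain) : Type :=
  {x : 'cV[R]_3 | in_domain U x}.

Definition degree_at_most (R : realType) (U : domain) (p : nat)
    (P : {mpoly R[3]}) : Prop :=
  match U with
  | Cube => {in msupp P, forall m : 'X_{1..3}, forall d, (m d <= p)%N}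
  | Tetrahedron => (msize P <= p.+1)%N
  end.

Definition polynomial_function (R : realType) (U : domain) (p : nat)
    (F : points R U -> 'cV[R]_3) : Prop :=
  exists P : 'I_3 -> {mpoly R[3]},
    (forall d, degree_at_most U p (P d)) /\
    (forall (x : points R U) (d : 'I_3),
      F x d 0 = (P d).@[fun e => sval x e 0]).

(* The nested pair ((i, j), k) stands for the index (i, j, k). *)
Definition bb_index : Type := (nat * nat * nat)%type.

Definition indices (U : domain) (p : nat) : seq bb_index :=
  let r := iota 0 p.+1 in
  let cube := [seq (ij, k) | ij <- [seq (i, j) | i <- r, j <- r], k <- r] in
  match U with
  | Cube => cube
  | Tetrahedron => [seq t <- cube | (t.1.1 + t.1.2 + t.2 <= p)%N]
  end.

Definition bernstein (R : realType) (U : domain) (p : nat) (t : bb_index)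
    (x : 'cV[R]_3) : R :=
  let: (i, j, k) := t in
  let xi := x 0 0 in
  let eta := x 1 0 in
  let zeta := x 2 0 in
  match U with
  | Cube =>
      'C(p, i)%:R * 'C(p, j)%:R * 'C(p, k)%:R
        * (1 - xi) ^+ (p - i) * xi ^+ i
        * (1 - eta) ^+ (p - j) * eta ^+ j
        * (1 - zeta) ^+ (p - k) * zeta ^+ k
  | Tetrahedron =>
      p`!%:R / (i`! * j`! * k`! * (p - i - j - k)`!)%:R
        * xi ^+ i * eta ^+ j * zeta ^+ k
        * (1 - xi - eta - zeta) ^+ (p - i - j - k)
  end.

(* Only the values of f on indices U p matter, and F determines these. *)
Definition control_points (R : realType) (U : domain) (p : nat)
    (F : points R U -> 'cV[R]_3) (f : bb_index -> 'cV[R]_3) : Prop :=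
  forall x : points R U,
    F x = \sum_(t <- indices U p) bernstein U p t (sval x) *: f t.

Definition next_xi (t : bb_index) : bb_index :=
  let: (i, j, k) := t in (i.+1, j, k).
Definition next_eta (t : bb_index) : bb_index :=
  let: (i, j, k) := t in (i, j.+1, k).
Definition next_zeta (t : bb_index) : bb_index :=
  let: (i, j, k) := t in (i, j, k.+1).

(* Control points of the partial derivative in the direction of next, from the
   forward differences of the control points f. *)
Definition derivative_points (R : realType) (U : domain) (p : nat)
    (f : bb_index -> 'cV[R]_3) (next : bb_index -> bb_index) : seq 'cV[R]_3 :=
  [seq p%:R *: (f (next t) - f t)
     | t <- indices U p & next t \in indices U p].

Definition hull (R : realType) (n : nat) (G : seq 'cV[R]_n) (u : 'cV[R]_n) :
    Prop :=
  exists a : 'I_(size G) -> R,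
    [/\ forall i, 0 <= a i,
        \sum_i a i = 1
      & u = \sum_i a i *: tnth (in_tuple G) i].

Definition columns (R : realType) (u v w : 'cV[R]_3) : 'M[R]_3 :=
  \matrix_(i, j) [:: u i 0; v i 0; w i 0]`_j.

Definition opp_list (R : realType) (n : nat) (G : seq 'cV[R]_n) :
    seq 'cV[R]_n :=
  [seq - f | f <- G].

Definition dot (R : realType) (n : nat) (h f : 'cV[R]_n) : R :=
  (h^T *m f) 0 0.

(* Main.v *)
Require Import Defs.
From mathcomp Require Import all_boot all_order all_algebra.
From mathcomp Require Import reals.
From mathcomp Require Import zify ring lra.

Set Implicit Arguments.
Unset Strict Implicit.
Unset Printing Implicit Defensive.

Import Order.TTheory GRing.Theory Num.Theory.
Local Open Scope ring_scope.

(* If [u], [v], [w] from the three hulls are linearly dependent, say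
   [a u + b v + c w = 0] with [0 <= a], then the vector [h_i] belonging to the
   signs of [b] and [c] is positive on every nonzero term of the left-hand
   side, a contradiction.  Conversely, by Gordan's alternative, the failure of
   one of the four sign patterns gives a vanishing nontrivial nonnegative
   combination of [Gxi], [±Geta] and [±Gzeta]; grouping its terms list by list
   and normalizing gives dependent points of the three hulls. *)

(** * Bilinearity and positivity of the dot product *)

Section Dot.
Variables (R : realType) (n : nat).
Implicit Types (h f g : 'cV[R]_n) (a : R).

Lemma dotE h f : dot h f = \sum_i h i 0 * f i 0.
Proof. by rewrite /dot mxE; apply: eq_bigr => i _; rewrite mxE. Qed.

Lemma dot0r h : dot h 0 = 0.
Proof. by rewrite /dot mulmx0 mxE. Qed.

Lemma dotDr h f g : dot h (f + g) = dot h f + dot h g.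
Proof. by rewrite /dot mulmxDr mxE. Qed.

Lemma dotNr h f : dot h (- f) = - dot h f.
Proof. by rewrite /dot mulmxN mxE. Qed.

Lemma dotZr h a f : dot h (a *: f) = a * dot h f.
Proof. by rewrite /dot -scalemxAr mxE. Qed.

Lemma dotDl h g f : dot (h + g) f = dot h f + dot g f.
Proof. by rewrite /dot linearD mulmxDl mxE. Qed.

Lemma dotZl h a f : dot (a *: h) f = a * dot h f.
Proof. by rewrite /dot linearZ -scalemxAl mxE. Qed.

Lemma dot_sumr h (I : finType) (F : I -> 'cV[R]_n) :
  dot h (\sum_i F i) = \sum_i dot h (F i).
Proof. by rewrite /dot mulmx_sumr summxE. Qed.

Lemma dot_gt0 f : f != 0 -> 0 < dot f f.
Proof.
move=> f0; rewrite lt_def dotE sumr_ge0 ?andbT => [|i _]; last first.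
  by rewrite -expr2 sqr_ge0.
apply: contra f0 => /eqP /psumr_eq0P s0; apply/eqP/matrixP => i j.
rewrite ord1 mxE; apply/eqP; rewrite -sqrf_eq0 expr2.
apply/eqP; apply: s0 => //.
by move=> k _; rewrite -expr2 sqr_ge0.
Qed.

End Dot.

(** With [S] the sum of the ratios [|y i| / x i], the choice [e = 1 / (1 + S)] works, because
    [|y i| <= S * x i < (1 + S) * x i]. In Gordan's alternative this allows a separating vector to
    be tilted without losing strict positivity. *)
Lemma small_perturbation (R : realFieldType) (I : finType) (x y : I -> R) :
  (forall i, 0 < x i) ->
  exists2 e, 0 < e & forall i, 0 < x i + e * y i.
Proof.
move=> x0; pose S := \sum_i `|y i| / x i.
have t0 i : 0 <= `|y i| / x i by rewrite divr_ge0 // ltW.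
have S0 : 0 < 1 + S by rewrite ltr_pwDl ?ltr01 ?sumr_ge0.
exists (1 + S)^-1; first by rewrite invr_gt0.
move=> i; have -> : x i + (1 + S)^-1 * y i = (x i * (1 + S) + y i) / (1 + S).
  by field; rewrite lt0r_neq0.
rewrite divr_gt0 //.
have : `|y i| / x i <= S by rewrite /S (bigD1 i) //= lerDl sumr_ge0.
rewrite ler_pdivrMr // => yS.
have : - `|y i| <= y i by rewrite lerNl -normrN ler_norm.
have := x0 i; rewrite mulrDr mulr1 (mulrC (x i)); lra.
Qed.

(** * Gordan's alternative for finite families of vectors *)

Section Gordan.
Variables (R : realType) (n : nat).

(** Induction on [m], splitting off the first vector [g0]. A vanishing combination of the others
    extends by the coefficient 0; otherwise some [h] is positive on the others, and the sign of
    [dot h g0] decides how to proceed. *)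
Lemma gordan_ord m (g : 'I_m -> 'cV[R]_n) :
  (exists h, forall i, 0 < dot h (g i)) \/
  (exists a : 'I_m -> R,
    [/\ forall i, 0 <= a i, exists i, 0 < a i & \sum_i a i *: g i = 0]).
Proof.
elim: m g => [|m IH] g; first by left; exists 0; case.
set g0 := g ord0; pose gs i := g (lift ord0 i).
have extend_combination b (a : 'I_m -> R) : 0 <= b -> (forall i, 0 <= a i) ->
    0 < b \/ (exists i, 0 < a i) -> b *: g0 + \sum_i a i *: gs i = 0 ->
    exists a' : 'I_m.+1 -> R,
      [/\ forall i, 0 <= a' i, exists i, 0 < a' i & \sum_i a' i *: g i = 0].
  move=> b0 a0 pos sum0; exists (fun i => oapp a b (unlift ord0 i)); split.
  - by move=> i; case: unliftP => [j|] _ /=.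
  - case: pos => [b1|[i ai]]; first by exists ord0; rewrite unlift_none.
    by exists (lift ord0 i); rewrite liftK.
  - rewrite big_ord_recl unlift_none /= -[RHS]sum0; congr (_ + _).
    by apply: eq_bigr => i _; rewrite liftK.
have extend_separation h : 0 < dot h g0 -> (forall i, 0 < dot h (gs i)) ->
    exists h', forall i, 0 < dot h' (g i).
  move=> h0 hs; exists h => i; case: (unliftP ord0 i) => [j|] -> //.
  exact: hs.
case: (IH gs) => [[h hs]|[a [a0 pos sum0]]]; last first.
  by right; apply: (extend_combination 0 a); rewrite ?scale0r ?add0r //; right.
have [hg0|hg0|hg0] := ltgtP (dot h g0) 0; last 1 first.
- have [g00|g00] := eqVneq g0 0.
    right; apply: (extend_combination 1 (fun=> 0)) => //; first by left.
    by rewrite g00 scaler0 add0r big1 // => i _; rewrite scale0r.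
  (* As [h] vanishes on [g0], a small multiple of [g0] added to [h] makes it positive there. *)
  have [e e0 he] := small_perturbation (fun i => dot g0 (gs i)) hs.
  left; apply: (extend_separation (h + e *: g0)) => [|i].
    by rewrite dotDl dotZl hg0 add0r mulr_gt0 // dot_gt0.
  by rewrite dotDl dotZl.
- (* Project the remaining vectors to the hyperplane orthogonal to [h], along
     [g0]. *)
  pose c i := - (dot h (gs i) / dot h g0).
  have c0 i : 0 < c i.
    by rewrite /c -mulrN -invrN divr_gt0 // oppr_gt0.
  case: (IH (fun i => gs i + c i *: g0)) => [[k ks]|[a [a0 [i ai] sum0]]].
    (* The multiple of [h] is chosen so that [k'] vanishes on [g0]; then [k'] takes on [gs i] the
       value of [k] on its projection. *)
    pose k' := k + - (dot k g0 / dot h g0) *: h.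
    have k'0 : dot k' g0 = 0.
      by rewrite dotDl dotZl; field; rewrite lt_eqF.
    have k's i : 0 < dot k' (gs i).
      have -> // : dot k' (gs i) = dot k (gs i + c i *: g0).
      by rewrite dotDl dotZl dotDr dotZr /c; field; rewrite lt_eqF.
    (* Since [dot h g0 < 0], subtracting a small multiple of [h] from [k'] gives a positive value on
       [g0]. *)
    have [e e0 he] := small_perturbation (fun i => - dot h (gs i)) k's.
    left; apply: (extend_separation (k' + (- e) *: h)) => [|i].
      by rewrite dotDl dotZl k'0 add0r mulNr -mulrN mulr_gt0 // oppr_gt0.
    by rewrite dotDl dotZl mulNr -mulrN.
  (* Expanding the projections collects the total weight of [g0]. *)
  right; apply: (extend_combination (\sum_i a i * c i) a) => //.
  - by apply: sumr_ge0 => j _; rewrite mulr_ge0 // ltW.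
  - by right; exists i.
  - rewrite -[RHS]sum0 scaler_suml -big_split /=.
    by apply: eq_bigr => j _; rewrite scalerDr scalerA addrC.
- by left; apply: (extend_separation h).
Qed.

(** An arbitrary finite index type allows three lists to be joined later as a disjoint sum. *)
Lemma gordan (I : finType) (g : I -> 'cV[R]_n) :
  (exists h, forall i, 0 < dot h (g i)) \/
  (exists a : I -> R,
    [/\ forall i, 0 <= a i, exists i, 0 < a i & \sum_i a i *: g i = 0]).
Proof.
case: (gordan_ord (fun i : 'I_#|I| => g (enum_val i))) => [[h hg]|].
  by left; exists h => i; rewrite -(enum_rankK i).
case=> a [a0 [i ai] sum0]; right; exists (fun x => a (enum_rank x)); split=> //.
  by exists (enum_val i); rewrite enum_valK.
rewrite -[RHS]sum0 (reindex (@enum_val I predT)) /=; last first.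
  by apply: onW_bij; apply: enum_val_bij.
by apply: eq_bigr => j _; rewrite enum_valK.
Qed.

End Gordan.

(** * Convex hulls and nonnegative combinations *)

Section Hull.
Variables (R : realType) (n : nat).
Implicit Types (G : seq 'cV[R]_n) (h u : 'cV[R]_n).

(** All terms of the convex combination have nonnegative dot product with [h]; if these added up to
    0, every weight would vanish, but the weights sum to 1. *)
Lemma hull_dot_gt0 G h u :
  (forall g, g \in G -> 0 < dot h g) -> hull G u -> 0 < dot h u.
Proof.
move=> hG [a [a0 a1 ->]]; rewrite dot_sumr.
have t0 i : 0 <= dot h (a i *: tnth (in_tuple G) i).
  by rewrite dotZr mulr_ge0 // ltW // hG // mem_tnth.
rewrite lt_def sumr_ge0 ?andbT //; apply/eqP => /psumr_eq0P s0.
have /eqP := oner_neq0 R; apply; rewrite -a1 big1 // => i _.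
have /eqP := s0 (fun i _ => t0 i) i isT.
rewrite dotZr mulf_eq0 => /orP[/eqP //|].
by rewrite gt_eqF // hG // mem_tnth.
Qed.

Lemma nonneg_combination_hull G (a : 'I_(size G) -> R) :
  (0 < size G)%N -> (forall i, 0 <= a i) ->
  exists2 u, hull G u &
    \sum_i a i *: tnth (in_tuple G) i = (\sum_i a i) *: u.
Proof.
(* If the total weight is 0, normalization is impossible, but both sides vanish and the first
   element of [G] serves as [u]. *)
move=> G0 a0; have [s0|s0] := eqVneq (\sum_i a i) 0.
  exists (tnth (in_tuple G) (Ordinal G0)).
    exists (fun i => (i == Ordinal G0)%:R); split=> [i||].
    - exact: ler0n.
    - by rewrite (bigD1 (Ordinal G0)) //= big1 ?addr0 ?eqxx // => i /negPf ->.
    - rewrite (bigD1 (Ordinal G0)) //= big1 ?addr0 ?eqxx ?scale1r // => i.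
      by move=> /negPf ->; rewrite scale0r.
  rewrite s0 scale0r big1 // => i _.
  by rewrite (psumr_eq0P _ s0) ?scale0r.
exists ((\sum_i a i)^-1 *: \sum_i a i *: tnth (in_tuple G) i); last first.
  by rewrite scalerA divff // scale1r.
exists (fun i => (\sum_i a i)^-1 * a i); split=> [i||].
- by rewrite mulr_ge0 // invr_ge0 sumr_ge0.
- by rewrite -mulr_sumr mulVf.
- by rewrite scaler_sumr; apply: eq_bigr => i _; rewrite scalerA.
Qed.

End Hull.

(** * Invertibility of the column matrix and separation by signs *)

Section Columns.
Variable R : realType.
Implicit Types (u v w y : 'cV[R]_3).

Lemma columns_mul u v w y :
  columns u v w *m y = y 0 0 *: u + y 1 0 *: v + y 2%:R 0 *: w.
Proof.
apply/matrixP => i j; rewrite ord1 !mxE !big_ord_recl big_ord0 !mxE /=.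
rewrite addr0 addrA -!(mulrC (y _ _)).
by congr (_ * _ + _ * _ + _ * _); congr (y _ _); apply/val_inj.
Qed.

Lemma columns_unitmxP u v w :
  reflect (forall a b c : R, a *: u + b *: v + c *: w = 0 ->
             [/\ a = 0, b = 0 & c = 0])
          (columns u v w \in unitmx).
Proof.
apply: (iffP idP) => [unit a b c abc0 | free].
  pose y : 'cV[R]_3 := \col_i [:: a; b; c]`_i.
  have y0 : y = 0.
    by rewrite -(mulKmx unit y) columns_mul !mxE /= abc0 mulmx0.
  split; [have := congr1 (fun z : 'cV[R]_3 => z 0 0) y0
    | have := congr1 (fun z : 'cV[R]_3 => z 1 0) y0
    | have := congr1 (fun z : 'cV[R]_3 => z 2%:R 0) y0]; by rewrite !mxE.
(* [det0P] yields a row vector in the left kernel, hence the passage to the transpose. *)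
rewrite -unitmx_tr unitmxE unitfE; apply/negP => /det0P[x x0 xA].
case/eqP: x0; apply/trmx_inj/matrixP => i j; rewrite ord1 linear0.
have := congr1 trmx xA; rewrite trmx_mul trmxK columns_mul linear0.
move=> /free[x1 x2 x3]; rewrite [RHS]mxE.
by case: i => [[|[|[|//]]] Hi]; [rewrite -x1|rewrite -x2|rewrite -x3];
  congr (_ _ _); apply/val_inj.
Qed.

Lemma sign_separated_free u v w :
  (forall s t : bool, exists h,
     [/\ 0 < dot h u, 0 < (-1) ^+ s * dot h v & 0 < (-1) ^+ t * dot h w]) ->
  forall a b c : R, a *: u + b *: v + c *: w = 0 -> [/\ a = 0, b = 0 & c = 0].
Proof.
move=> sep.
have nonneg (a b c : R) : 0 <= a -> a *: u + b *: v + c *: w = 0 ->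
    [/\ a = 0, b = 0 & c = 0].
  move=> a0 abc0; have [h [hu hv hw]] := sep (b < 0) (c < 0).
  have := congr1 (dot h) abc0; rewrite !dotDr !dotZr dot0r.
  (* Moving the signs of [b] and [c] onto the dot products turns the relation into a vanishing sum
     of three nonnegative terms. *)
  have signE (x z : R) : x * z = `|x| * ((-1) ^+ (x < 0)%R * z).
    by rewrite mulrCA mulrA -realEsign ?num_real.
  rewrite (signE b) (signE c) => /eqP.
  have pb : 0 <= `|b| * ((-1) ^+ (b < 0)%R * dot h v).
    by rewrite mulr_ge0 // ltW.
  have pc : 0 <= `|c| * ((-1) ^+ (c < 0)%R * dot h w).
    by rewrite mulr_ge0 // ltW.
  have pa : 0 <= a * dot h u by rewrite mulr_ge0 // ltW.
  rewrite !paddr_eq0 ?addr_ge0 // !mulf_eq0 => /andP[/andP[]].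
  move: hu hv hw; rewrite !lt0r !mulf_eq0 !signr_eq0 /=.
  move=> /andP[/negPf-> _] /andP[/negPf-> _] /andP[/negPf-> _].
  by rewrite !orbF !normr_eq0 => /eqP-> /eqP-> /eqP->.
move=> a b c abc0; have [/nonneg/(_ abc0)//|a0] := leP 0 a.
(* For [a < 0] the negated relation falls under the case already treated. *)
have [||] := nonneg (- a) (- b) (- c); first by rewrite oppr_ge0 ltW.
  by rewrite !scaleNr -!opprD abc0 oppr0.
by move=> /eqP + /eqP + /eqP; rewrite !oppr_eq0 => /eqP-> /eqP-> /eqP->.
Qed.

Lemma hull_columns_unitmx_separation (A B C : seq 'cV[R]_3) :
  (0 < size A)%N -> (0 < size B)%N -> (0 < size C)%N ->
  (forall u v w, hull A u -> hull B v -> hull C w ->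
     columns u v w \in unitmx) ->
  forall s t : bool, exists h,
    [/\ forall g, g \in A -> 0 < dot h g,
        forall g, g \in B -> 0 < (-1) ^+ s * dot h g
      & forall g, g \in C -> 0 < (-1) ^+ t * dot h g].
Proof.
move=> A0 B0 C0 unit s t.
(* The signs are absorbed into the vectors, so that one use of Gordan's alternative covers all three
   lists. *)
pose g (x : 'I_(size A) + ('I_(size B) + 'I_(size C))) :=
  match x with
  | inl i => tnth (in_tuple A) i
  | inr (inl j) => (-1) ^+ s *: tnth (in_tuple B) j
  | inr (inr k) => (-1) ^+ t *: tnth (in_tuple C) k
  end.
case: (gordan g) => [[h hg]|[a [a0 pos]]].
  exists h; split=> [x /(tnthP (in_tuple A))[i ->] |
      x /(tnthP (in_tuple B))[i ->] | x /(tnthP (in_tuple C))[i ->]].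
  - exact: (hg (inl i)).
  - by have := hg (inr (inl i)); rewrite dotZr.
  - by have := hg (inr (inr i)); rewrite dotZr.
rewrite !big_sumType /=.
have [u Au ->] := nonneg_combination_hull A0 (fun i => a0 (inl i)).
have [v Bv vE] := nonneg_combination_hull B0 (fun j => a0 (inr (inl j))).
have [w Cw wE] := nonneg_combination_hull C0 (fun k => a0 (inr (inr k))).
(* The signs are pulled out of the sums, leaving unsigned combinations of [B] and [C] that are
   multiples of the hull points [v] and [w]. *)
under [X in _ + (X + _)]eq_bigr do rewrite scalerA mulrC -scalerA.
under [X in _ + (_ + X)]eq_bigr do rewrite scalerA mulrC -scalerA.
rewrite -!scaler_sumr vE wE !scalerA addrA.
(* Independence of [u], [v], [w] makes the total weight of each list 0, so every [a x] vanishes,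
   against [pos]. *)
move=> /(columns_unitmxP _ _ _ (unit _ _ _ Au Bv Cw))[sa /eqP sb /eqP sc].
move: sb sc; rewrite !mulf_eq0 !signr_eq0 /= => sb sc.
case: pos => x; rewrite lt_def => /andP[/eqP ax _]; case: ax.
case: x => [i|[j|k]].
- by move/psumr_eq0P: sa; apply.
- by move/eqP/psumr_eq0P: sb; apply.
- by move/eqP/psumr_eq0P: sc; apply.
Qed.

Lemma hull_columns_unitmxP (A B C : seq 'cV[R]_3) :
  (0 < size A)%N -> (0 < size B)%N -> (0 < size C)%N ->
  (forall u v w, hull A u -> hull B v -> hull C w ->
     columns u v w \in unitmx)
  <->
  (forall s t : bool, exists h,
    [/\ forall g, g \in A -> 0 < dot h g,
        forall g, g \in B -> 0 < (-1) ^+ s * dot h g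
      & forall g, g \in C -> 0 < (-1) ^+ t * dot h g]).
Proof.
move=> A0 B0 C0; split; first exact: hull_columns_unitmx_separation.
move=> sep u v w Au Bv Cw; apply/columns_unitmxP/sign_separated_free => s t.
have [h [hA hB hC]] := sep s t; exists h.
split; first exact: hull_dot_gt0 Au.
  (* The sign is moved onto [h], so that [hull_dot_gt0] applies to the unsigned list. *)
  rewrite -dotZl; apply: hull_dot_gt0 Bv => x Bx; rewrite dotZl; exact: hB.
rewrite -dotZl; apply: hull_dot_gt0 Cw => x Cx; rewrite dotZl; exact: hC.
Qed.

End Columns.

(** * Application to the derivative control points *)

Lemma mem_indices U p i j k : (i + j + k <= p)%N -> (i, j, k) \in indices U p.
Proof.
move=> ijk.
have cube : (i, j, k) \in indices Cube p.
  by rewrite /indices !allpairs_f ?mem_iota //= add0n ltnS; lia.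
by case: U => //; rewrite mem_filter /= ijk.
Qed.

Lemma size_derivative_points_gt0 (R : realType) U p (f : bb_index -> 'cV[R]_3)
    next :
  (0, 0, 0)%N \in indices U p -> next (0, 0, 0)%N \in indices U p ->
  (0 < size (derivative_points U p f next))%N.
Proof.
move=> i0 i1; rewrite size_map -has_predT; apply/hasP.
by exists (0, 0, 0)%N => //; rewrite mem_filter i1.
Qed.

Lemma dot_signed_list_gt0 (R : realType) (n : nat) (s : bool)
    (G : seq 'cV[R]_n) h :
  (forall g, g \in (if s then opp_list G else G) -> 0 < dot h g) <->
  (forall g, g \in G -> 0 < (-1) ^+ s * dot h g).
Proof.
case: s; split=> hG g; rewrite ?expr1 ?mulN1r -?dotNr => Gg.
- by rewrite hG // map_f.
- case/mapP: Gg => x Gx ->.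
  by have := hG x Gx; rewrite expr1 mulN1r dotNr.
- by rewrite expr0 mul1r hG.
- by have := hG g Gg; rewrite expr0 mul1r.
Qed.

Lemma all_cat3 (T : eqType) (P : T -> Prop) (A B C : seq T) :
  (forall g, g \in A ++ B ++ C -> P g) <->
  [/\ forall g, g \in A -> P g, forall g, g \in B -> P g
    & forall g, g \in C -> P g].
Proof.
split=> [PG|[PA PB PC] g]; last by rewrite !mem_cat => /or3P[/PA|/PB|/PC].
by split=> g Gg; apply: PG; rewrite !mem_cat Gg ?orbT.
Qed.

Theorem mainTheorem3 (R : realType) (U : domain) (p : nat) (hp : (1 <= p)%N)
    (F : points R U -> 'cV[R]_3) (hF : polynomial_function p F)
    (f : bb_index -> 'cV[R]_3) (hf : control_points p F f) :
  let Gxi := derivative_points U p f next_xi in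
  let Geta := derivative_points U p f next_eta in
  let Gzeta := derivative_points U p f next_zeta in
  (forall u v w : 'cV[R]_3,
      hull Gxi u -> hull Geta v -> hull Gzeta w ->
      columns u v w \in unitmx)
  <->
  (exists h1 h2 h3 h4 : 'cV[R]_3,
      [/\ forall g, g \in Gxi ++ Geta ++ Gzeta -> 0 < dot h1 g,
          forall g, g \in Gxi ++ Geta ++ opp_list Gzeta -> 0 < dot h2 g,
          forall g, g \in Gxi ++ opp_list Geta ++ Gzeta -> 0 < dot h3 g
        & forall g, g \in Gxi ++ opp_list Geta ++ opp_list Gzeta ->
            0 < dot h4 g]).
Proof.
move=> Gxi Geta Gzeta.
have -> := @hull_columns_unitmxP R Gxi Geta Gzeta; last 3 first.
(* The origin and its three neighbours have index sum at most 1, which [hp] bounds by [p]; so no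
   list is empty on either domain. *)
1-3: by apply: size_derivative_points_gt0; apply: mem_indices.
(* The booleans [s] and [t] record whether [Geta] and [Gzeta] are negated; the four pairs, in
   lexicographic order with [false] first, correspond to [h1], [h2], [h3], [h4]. *)
have signedE s t h :
    (forall g, g \in Gxi ++ (if s then opp_list Geta else Geta) ++
                 (if t then opp_list Gzeta else Gzeta) -> 0 < dot h g) <->
    [/\ forall g, g \in Gxi -> 0 < dot h g,
        forall g, g \in Geta -> 0 < (-1) ^+ s * dot h g
      & forall g, g \in Gzeta -> 0 < (-1) ^+ t * dot h g].
  rewrite all_cat3; have [B1 B2] := dot_signed_list_gt0 s Geta h.
  have [C1 C2] := dot_signed_list_gt0 t Gzeta h.
  by split=> -[A B C]; split=> //; auto.
split=> [sep | [h1 [h2 [h3 [h4 [H1 H2 H3 H4]]]]] s t].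
  have [h1 /signedE H1] := sep false false.
  have [h2 /signedE H2] := sep false true.
  have [h3 /signedE H3] := sep true false.
  have [h4 /signedE H4] := sep true true.
  by exists h1, h2, h3, h4.
by case: s t => [] []; [exists h4|exists h3|exists h2|exists h1]; apply/signedE.
Qed.
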